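(* Let $n\ge1$. If $I$ is a nonempty subset of $[n]$ and $k\ge0$ is an integer, then \[ \mathbb{P}\big(C_I(\sigma)\ge k\big)\le\frac{H(I)^k}{k!}. \]
   Context: $[n]=\{1,\ldots,n\}$. The probability $\mathbb{P}$ is with respect to a uniformly random permutation $\sigma$ in the symmetric group $\mathcal{S}_n$ on $[n]$. For $I\subseteq[n]$, $C_I(\sigma)$ is the number of cycles of $\sigma$ whose lengths lie in $I$ (fixed points count as cycles of length 1), and $H(I)=\sum_{j\in I}1/j$. *)

(* Defs.v *)
From mathcomp Require Import all_boot all_order all_algebra all_fingroup.
From mathcomp Require Import finmap.

Set Implicit Arguments.
Unset Strict Implicit.
Unset Printing Implicit Defensive.

Import GRing.Theory Num.Theory.
Local Open Scope ring_scope.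

(* Every quantity involved is rational, so probabilities take values in rat. *)
Definition unifPr (T : finType) (E : {set T}) : rat := #|E|%:R / #|T|%:R.

(* The permuted set [n] is encoded as 'I_n = {0, ..., n-1}; the index set I
   contains actual cycle lengths, with no shift. porbits includes the
   singleton orbits, so fixed points count as cycles of length 1. *)
Definition cycle_count (n : nat) (I : {fset nat}) (s : 'S_n) : nat :=
  #|[set c in porbits s | #|c| \in I]|.

Definition harmonic_sum (I : {fset nat}) : rat := \sum_(j <- I) j%:R^-1.

(* Main.v *)
Require Import Defs.
From mathcomp Require Import all_boot all_order all_algebra all_fingroup.
From mathcomp Require Import finmap.

(** By Markov's inequality for the falling factorial [C ^_ k], where C is the
    number of cycles with length in I, it is enough to show
<<
      sum_(s in S_n) C(s) ^_ k  <=  n! * H(I)^k.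
>>
    Now [C(s) ^_ k] counts the k-tuples of distinct cycles of s with lengths in
    I. Marking a point in each cycle of such a tuple multiplies their number by
    the product of the lengths, so the count is recovered by giving each marked
    tuple the inverse of that product as its weight
    ([sum_inv_marked_cycles]).

    Sort the marked tuples by their lengths j_1, ..., j_k. For fixed lengths,
    at most n! pairs (permutation, marked tuple) exist
    ([card_marked_with_lengths]): writing each chosen cycle from its marked
    point, and then the images of the other points in a fixed order, yields an
    arrangement of the n points from which the pair can be read back, because
    the j_i tell where each cycle ends in the arrangement. Hence the sum over s
    is at most n! times the sum of 1 / (j_1 ... j_k) over all (j_1, ..., j_k) in
    I^k, and this last sum is H(I)^k ([sum_ffact_cycle_count]). *)

Set Implicit Arguments.
Unset Strict Implicit.
Unset Printing Implicit Defensive.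
Import Order.TTheory GRing.Theory Num.Theory.
Local Open Scope ring_scope.

Section MarkedCycles.

Variables T K : finType.
Implicit Types (s : {perm T}) (x : {ffun K -> T}).

Definition marked_cycles s x : {ffun K -> {set T}} := [ffun i => porbit s (x i)].

Section FixedLengths.

Variable len : K -> nat.

Definition marked_with_lengths (p : {perm T} * {ffun K -> T}) : bool :=
  injectiveb (marked_cycles p.1 p.2)
  && [forall i, #|porbit p.1 (p.2 i)| == len i].

Definition cycle_runs (p : {perm T} * {ffun K -> T}) : seq (seq T) :=
  [seq traject p.1 (p.2 i) (len i) | i <- enum K].

Definition cycle_word (p : {perm T} * {ffun K -> T}) : seq T :=
  flatten (cycle_runs p)
  ++ [seq p.1 y | y <- enum T & y \notin flatten (cycle_runs p)].

Lemma mem_cycle_runs p y : marked_with_lengths p ->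
  (y \in flatten (cycle_runs p)) = [exists i, y \in porbit p.1 (p.2 i)].
Proof.
case: p => s x /andP[_ /forallP /= lenP].
apply/flatten_mapP/existsP => /= [[i _]|[i]].
  by rewrite -(eqP (lenP i)) -porbit_traject; exists i.
by exists i; rewrite ?mem_enum // -(eqP (lenP i)) -porbit_traject.
Qed.

(** Each run lists one cycle, and distinct cycles are disjoint. *)
Lemma uniq_cycle_runs p : marked_with_lengths p -> uniq (flatten (cycle_runs p)).
Proof.
case: p => s x /andP[/= /injectiveP injx /forallP /= lenP].
have := enum_uniq K; rewrite /cycle_runs /=; elim: (enum K) => //= i e IHe.
case/andP=> ie /IHe ue; rewrite cat_uniq ue andbT.
rewrite -(eqP (lenP i)) uniq_traject_porbit /=.
apply/hasPn => y /flatten_mapP[i' i'e].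
rewrite /= -(eqP (lenP i')) -!porbit_traject => yi'; apply/negP => yi.
have ii' : i = i'.
  apply: injx; rewrite !ffunE; move: yi yi'.
  by rewrite -!eq_porbit_mem => /eqP<- /eqP<-.
by rewrite ii' i'e in ie.
Qed.

(** The chosen points form a union of cycles; so the permutation also preserves
    the set of the other points, whose images fill the end of the word. *)
Lemma cycle_runs_stable p y : marked_with_lengths p ->
  (p.1 y \in flatten (cycle_runs p)) = (y \in flatten (cycle_runs p)).
Proof.
move=> mp; rewrite !mem_cycle_runs //; apply: eq_existsb => i.
have /eqP same_cycle : porbit p.1 (p.1 y) == porbit p.1 y.
  by rewrite eq_porbit_mem; apply: (mem_porbit p.1 1).
by rewrite -!eq_porbit_mem same_cycle.
Qed.

Lemma uniq_cycle_word p : marked_with_lengths p -> uniq (cycle_word p).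
Proof.
move=> mp; rewrite cat_uniq uniq_cycle_runs //= map_inj_uniq; last exact: perm_inj.
rewrite filter_uniq ?enum_uniq // andbT.
apply/hasPn => _ /mapP[y + ->]; rewrite mem_filter => /andP[yR _] /=.
by rewrite cycle_runs_stable.
Qed.

Lemma size_cycle_word p : marked_with_lengths p -> size (cycle_word p) = #|T|.
Proof.
move=> mp; rewrite -(card_uniqP (uniq_cycle_word mp)); apply: eq_card => y.
rewrite inE mem_cat; apply/orP.
have [yR|yR] := boolP (y \in flatten (cycle_runs p)); [by left | right].
apply/mapP; exists ((p.1)^-1%g y); last by rewrite permKV.
by rewrite mem_filter mem_enum -cycle_runs_stable // permKV yR.
Qed.

(** The lengths cut the word into its runs. A run is an initial segment of the
    orbit of its marked point, and the orbit closes up after the last letter, so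
    it determines the permutation on that cycle. The runs also determine which
    points are left over, hence which images the end of the word lists. *)
Lemma cycle_word_inj : {in marked_with_lengths &, injective cycle_word}.
Proof.
move=> [s x] [s' x'] mp mp' eqw.
have shapeE : shape (cycle_runs (s, x)) = shape (cycle_runs (s', x')).
  by rewrite /shape -!map_comp; apply: eq_map => i /=; rewrite !size_traject.
have /eqP := eqw; rewrite eqseq_cat ?size_flatten ?shapeE //.
case/andP=> /eqP eqR; rewrite -eqR => /eqP eq_rest.
have eq_runs i : traject s (x i) (len i) = traject s' (x' i) (len i).
  have /eq_in_map := eq_from_flatten_shape eqR shapeE.
  by apply; rewrite mem_enum.
case/andP: (mp) (mp') => _ /forallP /= lenP /andP[_ /forallP /= lenP'].
have len_gt0 i : (0 < len i)%N.
  by rewrite -(eqP (lenP i)) (cardD1 (x i)) porbit_id.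
have eq_iter i m : (m <= len i)%N -> iter m s (x i) = iter m s' (x' i).
  have lt_iter m' : (m' < len i)%N -> iter m' s (x i) = iter m' s' (x' i).
    move=> ltm; rewrite -(nth_traject s ltm) -(nth_traject s' ltm).
    by rewrite eq_runs; apply: set_nth_default; rewrite size_traject.
  (* At m = len i both orbits have returned to the common marked point. *)
  rewrite leq_eqVlt => /predU1P[->|/lt_iter //].
  rewrite -{1}(eqP (lenP i)) -(eqP (lenP' i)) !iter_porbit.
  exact: (lt_iter 0%N).
have eqx : x = x' by apply/ffunP => i; have /= := eq_iter i 0%N (ltnW (len_gt0 i)).
congr (_, _) => //; apply/permP => y.
have [|yR] := boolP (y \in flatten (cycle_runs (s, x))).
  case/flatten_mapP=> i _ /trajectP[m ltm ->] /=.
  by rewrite -[LHS]/(iter m.+1 s (x i)) eq_iter // iterS -eq_iter // ltnW.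
by move/eq_in_map: eq_rest; apply; rewrite mem_filter yR mem_enum.
Qed.

(** The words are arrangements of all the points of T, and there are #|T|! of
    these. Equality holds when the lengths are positive with sum at most #|T|. *)
Lemma card_marked_with_lengths : (#|marked_with_lengths| <= #|T| `!)%N.
Proof.
(* The default tuple is never reached: marked words have length #|T|. *)
pose word p : #|T|.-tuple T := insubd (enum_tuple T) (cycle_word p).
have wordE p : marked_with_lengths p -> word p = cycle_word p :> seq T.
  by move=> mp; rewrite val_insubd size_cycle_word ?eqxx.
have word_inj : {in marked_with_lengths &, injective word}.
  move=> p q mp mq eqw; apply: cycle_word_inj => //.
  by rewrite -!wordE // eqw.
rewrite -(card_in_imset word_inj) -ffactnn -card_uniq_tuples.
apply/subset_leq_card/subsetP => _ /imsetP[p mp ->].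
rewrite inE wordE //; apply/andP; split; first exact/allP.
exact: uniq_cycle_word.
Qed.

End FixedLengths.

(** A tuple of distinct cycles c_i can be marked in prod_i #|c_i| ways, and each
    of them has the inverse of this product as its weight. So every tuple
    contributes 1, and the number of tuples is the falling factorial. *)
Lemma sum_inv_marked_cycles s (D : {set {set T}}) : D \subset porbits s ->
  \sum_(x | (marked_cycles s x \in ffun_on D) && injectiveb (marked_cycles s x))
    \prod_i (#|porbit s (x i)|%:R^-1 : rat) = (#|D| ^_ #|K|)%:R.
Proof.
move=> /subsetP sD; rewrite -card_inj_ffuns_on -sum1_card natr_sum.
pose good (c : {ffun K -> {set T}}) := (c \in ffun_on D) && injectiveb c.
rewrite (partition_big (marked_cycles s) good) //= /good.
apply: eq_big => [c|c /andP[/ffun_onP cD injc]]; first by rewrite [in RHS]in_set.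
transitivity (\prod_i \sum_(y | porbit s y == c i) (#|c i|%:R^-1 : rat)).
  rewrite (bigA_distr_big_dep (fun i y => porbit s y == c i)) /=.
  apply: eq_big => [x|x /andP[_ /eqP<-]]; last first.
    by apply: eq_bigr => i _; rewrite ffunE.
  have eqc : (marked_cycles s x == c) = (x \in family (fun i y => porbit s y == c i)).
    apply/eqP/familyP => [<- i|xc]; first by rewrite ffunE; apply: eqxx.
    by apply/ffunP => i; rewrite ffunE; apply/eqP; exact: xc.
  rewrite eqc andb_idl // -eqc => /eqP->; rewrite injc andbT.
  exact/ffun_onP.
apply: big1 => i _; have /imsetP[y _ cy] := sD _ (cD i).
rewrite (eq_bigl (fun z => z \in c i)) => [|z]; last by rewrite cy eq_porbit_mem.
rewrite sumr_const -[LHS]mulr_natl mulfV // pnatr_eq0 -lt0n cy.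
by rewrite (cardD1 y) porbit_id.
Qed.

End MarkedCycles.

(** The k-th factorial moment bound, with both sides multiplied by n!. The weight
    of a marked tuple depends only on its cycle lengths, which allows the bound
    for fixed lengths to be applied inside the sum over all lengths. *)
Lemma sum_ffact_cycle_count (n k : nat) (I : {fset nat}) :
  \sum_(s : 'S_n) ((cycle_count I s ^_ k)%:R : rat)
    <= n`!%:R * (\sum_(j < n.+1 | (j : nat) \in I) j%:R^-1) ^+ k.
Proof.
pose inI (j : 'I_n.+1) := (j : nat) \in I.
pose admissible (s : 'S_n) (x : {ffun 'I_k -> 'I_n}) :=
  (marked_cycles s x \in ffun_on [set c in porbits s | #|c| \in I])
  && injectiveb (marked_cycles s x).
pose lengths s (x : {ffun 'I_k -> 'I_n}) : {ffun 'I_k -> 'I_n.+1} :=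
  [ffun i => inord #|porbit s (x i)|].
have lengthsE s x i : lengths s x i = #|porbit s (x i)| :> nat.
  by rewrite ffunE inordK // ltnS -[leqRHS]card_ord max_card.
have lengthsI s x : admissible s x -> lengths s x \in ffun_on inI.
  case/andP=> /ffun_onP xD _; apply/ffun_onP => i.
  rewrite unfold_in /inI lengthsE.
  by have := xD i; rewrite ffunE inE => /andP[].
have -> : \sum_(s : 'S_n) ((cycle_count I s ^_ k)%:R : rat) =
    \sum_(j in ffun_on inI) \sum_(s : 'S_n)
      \sum_(x | admissible s x && (lengths s x == j)) \prod_i (j i)%:R^-1.
  rewrite exchange_big; apply: eq_bigr => s _ /=.
  have := @sum_inv_marked_cycles _ 'I_k s [set c in porbits s | #|c| \in I].
  rewrite card_ord => <-; last by apply/subsetP => c; rewrite inE => /andP[].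
  rewrite (partition_big (lengths s) (mem (ffun_on inI))) /=; last exact: lengthsI.
  apply: eq_bigr => j _; apply: eq_bigr => x /andP[_ /eqP<-].
  by apply: eq_bigr => i _; rewrite lengthsE.
have -> : (\sum_(j < n.+1 | inI j) j%:R^-1 : rat) ^+ k =
    \sum_(j in ffun_on inI) \prod_(i < k) (j i)%:R^-1.
  rewrite -[X in _ ^+ X]card_ord -prodr_const.
  exact: (bigA_distr_big inI (fun=> fun j : 'I_n.+1 => j%:R^-1)).
rewrite mulr_sumr; apply: ler_sum => j _.
(* The inner double sum is the constant weight of j times a number of pairs. *)
rewrite pair_big_dep sumr_const -[leLHS]mulr_natl.
apply: ler_wpM2r; first by apply: prodr_ge0 => i _; rewrite invr_ge0 ler0n.
rewrite ler_nat.
have := @card_marked_with_lengths 'I_n 'I_k (fun i => j i); rewrite card_ord.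
apply: leq_trans; apply/subset_leq_card/subsetP => -[s x] /= /andP[/andP[_ injx] /eqP<-].
apply/andP; split=> //; apply/forallP => i; by rewrite lengthsE.
Qed.

Lemma sum_inv_mem_leq (n : nat) (I : {fset nat}) :
  (forall j : nat, j \in I -> (j <= n)%N) ->
  \sum_(j < n.+1 | (j : nat) \in I) j%:R^-1 = harmonic_sum I.
Proof.
move=> leI; rewrite -(big_mkord (fun j => j \in I) (fun j => j%:R^-1)) -big_filter.
apply/perm_big/uniq_perm; rewrite ?filter_uniq ?iota_uniq ?fset_uniq // => j.
by rewrite mem_filter mem_index_iota /= ltnS andb_idr // => /leI.
Qed.

Theorem theorem1p9 (n : nat) (hn : (1 <= n)%N) (I : {fset nat})
    (hI0 : I != fset0) (hI : forall j : nat, j \in I -> (1 <= j <= n)%N)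
    (k : nat) :
  unifPr [set s : 'S_n | (k <= cycle_count I s)%N]
    <= harmonic_sum I ^+ k / k`!%:R.
Proof.
have fact_pos m : 0 < m`!%:R :> rat by rewrite ltr0n fact_gt0.
have leI j : j \in I -> (j <= n)%N by case/hI/andP.
rewrite /unifPr card_Sn ler_pdivrMr // mulrAC ler_pdivlMr // [leRHS]mulrC.
rewrite -(sum_inv_mem_leq leI).
apply: le_trans (sum_ffact_cycle_count n k I).
(* Markov: C ^_ k >= k! whenever C >= k. *)
rewrite -natrM -natr_sum ler_nat -sum_nat_const big_mkcond /=.
apply: leq_sum => s _; rewrite inE; case: ifP => // lek.
by rewrite -bin_ffact leq_pmull // bin_gt0.
Qed.
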